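(* Let $A,X\in\mathbb{C}^{m\times n}$, $W\in\mathbb{C}^{n\times m}$ and $k=\max\{\mathrm{ind}(AW),\mathrm{ind}(WA)\}$. Then the following are equivalent: (1) $A^{\mathrm{cEP},W}=X$; (2) $XW(AW)^{k+1}=(AW)^k$, $AWXWX=X$ and $(WAWX)^*=WAWX$.
   Context: For a square complex matrix $B$, $\mathrm{ind}(B)$ is the smallest non-negative integer $j$ with $\mathrm{rank}(B^j)=\mathrm{rank}(B^{j+1})$ (with $B^0=I$). $B^*$, $B^{\dagger}$ and $\mathcal{R}(B)$ denote the conjugate transpose, Moore-Penrose inverse and range (column space) of $B$. For $A\in\mathbb{C}^{m\times n}$, $W\in\mathbb{C}^{n\times m}$ and $k=\max\{\mathrm{ind}(AW),\mathrm{ind}(WA)\}$, the $W$-weighted core-EP inverse $A^{\mathrm{cEP},W}$ is the unique $Y\in\mathbb{C}^{m\times n}$ with $WAWY=(WA)^k[(WA)^k]^{\dagger}$ and $\mathcal{R}(Y)\subseteq\mathcal{R}((AW)^k)$. *)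

(* Defs.v *)
From mathcomp Require Import all_boot all_order all_algebra.
From mathcomp Require Import boolp classical_sets reals.
From mathcomp Require Export complex.

Set Implicit Arguments.
Unset Strict Implicit.
Unset Printing Implicit Defensive.

Import Order.TTheory GRing.Theory Num.Theory.
Local Open Scope ring_scope.
Local Open Scope sesquilinear_scope.
Local Open Scope classical_set_scope.

Lemma mxrank_exp_stationary (F : fieldType) n (B : 'M[F]_n) :
  exists j, \rank (B ^+ j) == \rank (B ^+ j.+1).
Proof.
apply: contrapT => nostat.
have lt j : (\rank (B ^+ j.+1) < \rank (B ^+ j))%N.
  have := mxrankM_maxr B (B ^+ j); rewrite -[B *m _]exprS leq_eqVlt.
  by case/orP => // /eqP e; case: nostat; exists j; rewrite e.
have le j : (\rank (B ^+ j) + j <= n)%N.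
  elim: j => [|j IHj]; first by rewrite addn0 rank_leq_row.
  by apply: leq_trans IHj; rewrite addnS -addSn leq_add2r.
by have := leq_trans (leq_addl _ _) (le n.+1); rewrite ltnn.
Qed.

Definition mxind (F : fieldType) n (B : 'M[F]_n) : nat :=
  ex_minn (mxrank_exp_stationary B).

(* MathComp's row-space order [(_ <= _)%MS] is about rows; this is R(B),
   the set of all B v for v a column vector. *)
Definition mxrange (F : fieldType) m n (B : 'M[F]_(m, n)) : set 'cV[F]_m :=
  range (fun v : 'cV[F]_n => B *m v).

Definition is_mpinv (C : numClosedFieldType) m n
    (B : 'M[C]_(m, n)) (G : 'M[C]_(n, m)) : Prop :=
  [/\ B *m G *m B = B, G *m B *m G = G,
      (B *m G)^t* = B *m G & (G *m B)^t* = G *m B].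

(* The four Penrose equations have exactly one solution, so the default value
   0 of [xget] is never used. *)
Definition mpinv (C : numClosedFieldType) m n (B : 'M[C]_(m, n)) :
  'M[C]_(n, m) := xget 0 [set G | is_mpinv B G].

Definition windex (F : fieldType) m n
    (A : 'M[F]_(m, n)) (W : 'M[F]_(n, m)) : nat :=
  maxn (mxind (A *m W)) (mxind (W *m A)).

Definition is_wcEP (C : numClosedFieldType) m n
    (A : 'M[C]_(m, n)) (W : 'M[C]_(n, m)) (Y : 'M[C]_(m, n)) : Prop :=
  let k := windex A W in
  W *m A *m W *m Y = (W *m A) ^+ k *m mpinv ((W *m A) ^+ k) /\
  mxrange Y `<=` mxrange ((A *m W) ^+ k).

(* As for [mpinv], exactly one matrix satisfies [is_wcEP A W]. *)
Definition wcEP (C : numClosedFieldType) m n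
    (A : 'M[C]_(m, n)) (W : 'M[C]_(n, m)) : 'M[C]_(m, n) :=
  xget 0 [set Y | is_wcEP A W Y].

(* Main.v *)
Require Import Defs.
From mathcomp Require Import all_boot all_order all_algebra.
From mathcomp Require Import boolp classical_sets reals.

Set Implicit Arguments.
Unset Strict Implicit.
Unset Printing Implicit Defensive.

Import GRing.Theory Num.Theory.
Local Open Scope ring_scope.
Local Open Scope sesquilinear_scope.

(** Write [P = AW] and [Q = WA], so that [W P = Q W] and [A Q = P A]. Once [k]
    is at least the index of [P] and of [Q], the powers from [k] on have the
    same range: [Q ^ k = Q ^ (k + 2) T], and dually [P ^ k = S P ^ (k + 2)]
    ([mxind_expr]). The second identity makes [W P] injective on the range of
    [P ^ k] ([windex_cancel]), so an equation between matrices with columns in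
    that range may be checked after multiplication by [W P]. This gives
    uniqueness of the weighted core-EP inverse [X] and reduces the equations
    [X W P ^ (k + 1) = P ^ k] and [P X W X = X] to the fact that the projector
    [E = Q ^ k (Q ^ k)^+ = W P X] fixes every column of [Q ^ k]; the third
    equation says that [E] is Hermitian. The first identity gives existence: it
    writes [E] as [W P Y] with [Y] in the range of [P ^ k].

    Conversely, iterating [X = P X W X] gives [X = P ^ k X (W X) ^ k], whence
    the range inclusion, and the three equations say that [F = W P X] is a
    Hermitian matrix with range inside that of [Q ^ k] and fixing [Q ^ k]. An
    orthogonal projector is determined by its range, so [F = E]. *)

(** * Powers of square matrices *)

(** [exprS] and [exprSr] with the ring product of square matrices spelled [*m],
    so that [mulmxA] can regroup the result with rectangular factors. *)
Lemma mxexpS (R : pzRingType) n (B : 'M[R]_n) j : B ^+ j.+1 = B *m B ^+ j.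
Proof. exact: exprS. Qed.

Lemma mxexpSr (R : pzRingType) n (B : 'M[R]_n) j : B ^+ j.+1 = B ^+ j *m B.
Proof. exact: exprSr. Qed.

Lemma mxexp_intertwine (R : pzRingType) m n (A : 'M[R]_(m, n))
    (W : 'M[R]_(n, m)) j :
  W *m (A *m W) ^+ j = (W *m A) ^+ j *m W.
Proof.
elim: j => [|j IHj]; first by rewrite !expr0 mulmx1 mul1mx.
by rewrite mxexpSr mulmxA IHj mxexpSr !mulmxA.
Qed.

(** From the index on, equal rank of consecutive powers upgrades to equality of
    their row spaces and of their column spaces, and this propagates to all
    higher powers by multiplying with [B]. *)
Lemma mxind_expr (F : fieldType) n (B : 'M[F]_n) k j :
  (mxind B <= k)%N ->
  (exists S, B ^+ k = S *m B ^+ (k + j)) /\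
  (exists T, B ^+ k = B ^+ (k + j) *m T).
Proof.
rewrite /mxind; case: ex_minnP => i /eqP rk_i _ le_ik.
have [S eS] : exists S, B ^+ i = S *m B ^+ i.+1.
  apply/submxP; have sub : (B ^+ i.+1 <= B ^+ i)%MS by rewrite mxexpS submxMl.
  by rewrite -(mxrank_leqif_sup sub) rk_i.
have [T eT] : exists T, B ^+ i = B ^+ i.+1 *m T.
  have sub : ((B ^+ i.+1)^T <= (B ^+ i)^T)%MS.
    by rewrite mxexpSr trmx_mul submxMl.
  have /submxP[D eD] : ((B ^+ i)^T <= (B ^+ i.+1)^T)%MS.
    by rewrite -(mxrank_leqif_sup sub) !mxrank_tr rk_i.
  by exists D^T; apply: trmx_inj; rewrite trmx_mul trmxK.
have stepS l : (i <= l)%N -> B ^+ l = S *m B ^+ l.+1.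
  move=> /subnKC <-; rewrite -addSn !exprD {1}eS.
  by rewrite -[_ * _]/(_ *m _) -[X in _ = _ *m X]/(_ *m _) mulmxA.
have stepT l : (i <= l)%N -> B ^+ l = B ^+ l.+1 *m T.
  move=> /subnK <-; rewrite -addnS !exprD {1}eT.
  by rewrite -[_ * _]/(_ *m _) -[X in _ = X *m _]/(_ *m _) mulmxA.
elim: j => [|j [[S' eS'] [T' eT']]].
  by rewrite addn0; split; exists 1%:M; rewrite ?mul1mx ?mulmx1.
have le_ikj : (i <= k + j)%N := leq_trans le_ik (leq_addr _ _).
split; [exists (S' *m S) | exists (T *m T')]; rewrite addnS.
  by rewrite -mulmxA -stepS.
by rewrite mulmxA -stepT.
Qed.

(** * Column ranges *)

Lemma mxrange_subP (F : fieldType) m n p (Y : 'M[F]_(m, n)) (B : 'M[F]_(m, p)) :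
  (mxrange Y `<=` mxrange B)%classic <-> exists Z, Y = B *m Z.
Proof.
split=> [sYB | [Z ->] _ [v _ <-]]; last by exists (Z *m v); rewrite // mulmxA.
have /choice[z ez] (j : 'I_n) : exists z, B *m z = col j Y.
  have [|z _ ez] := sYB (col j Y); last by exists z.
  by exists (delta_mx j 0); rewrite // colE.
exists (\matrix_(i, j) z j i 0); apply/matrixP => i j.
have /matrixP/(_ i 0) := ez j; rewrite !mxE => <-.
by apply: eq_bigr => l _; rewrite mxE.
Qed.

(** * The Moore-Penrose inverse *)

Lemma trmxC_mul (C : numClosedFieldType) m n p
    (A : 'M[C]_(m, n)) (B : 'M[C]_(n, p)) :
  (A *m B)^t* = B^t* *m A^t*.
Proof. by rewrite trmx_mul map_mxM. Qed.

Lemma trmxC_inv (C : numClosedFieldType) n (A : 'M[C]_n) :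
  (invmx A)^t* = invmx (A^t*).
Proof. by rewrite trmx_inv map_invmx. Qed.

(** A row vector [v] killed by the Gram matrix has
    [|v M|^2 = v (M M') v' = 0] with primes for adjoints, so [v M = 0]. *)
Lemma row_free_gram_unit (C : numClosedFieldType) m n (M : 'M[C]_(m, n)) :
  row_free M -> M *m M^t* \in unitmx.
Proof.
move=> freeM; rewrite -row_free_unit; apply: inj_row_free => v vMM.
apply: (row_free_inj freeM); rewrite mul0mx.
apply/eqP; rewrite -(dnorm_eq0 (@dotmx C n)) /= dotmxE.
by rewrite trmxC_mul mulmxA -(mulmxA v) vMM mul0mx mxE.
Qed.

(** The formula is forced: a Moore-Penrose inverse has the form [L' D K'], where
    primes denote adjoints, and the first Penrose equation then makes [D] the
    inverse of [(K' K) (L L')]. *)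
Lemma full_rank_is_mpinv (C : numClosedFieldType) m n r
    (K : 'M[C]_(m, r)) (L : 'M[C]_(r, n)) :
  row_full K -> row_free L ->
  is_mpinv (K *m L)
    (L^t* *m invmx (L *m L^t*) *m invmx (K^t* *m K) *m K^t*).
Proof.
move=> fullK freeL.
have uL : L *m L^t* \in unitmx := row_free_gram_unit freeL.
have uK : K^t* *m K \in unitmx.
  rewrite -{2}[K]trmxCK; apply: row_free_gram_unit.
  by rewrite /row_free mxrank_map mxrank_tr.
set iL := invmx (L *m L^t*); set iK := invmx (K^t* *m K).
have hL : iL^t* = iL by rewrite trmxC_inv trmxC_mul trmxCK.
have hK : iK^t* = iK by rewrite trmxC_inv trmxC_mul trmxCK.
set G := L^t* *m iL *m iK *m K^t*.
have BG : K *m L *m G = K *m iK *m K^t*.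
  by rewrite /G !mulmxA -(mulmxA K) -(mulmxA K) mulmxV // mulmx1.
have GB : G *m (K *m L) = L^t* *m iL *m L.
  by rewrite /G !mulmxA -(mulmxA _ (K^t*)) -(mulmxA _ iK) mulVmx // mulmx1.
split.
- by rewrite BG !mulmxA -(mulmxA _ (K^t*)) -(mulmxA _ iK) mulVmx // mulmx1.
- rewrite GB /G !mulmxA -(mulmxA _ L) -(mulmxA _ (L *m _)).
  by rewrite mulmxV // mulmx1.
- by rewrite BG !trmxC_mul hK trmxCK mulmxA.
- by rewrite GB !trmxC_mul hL trmxCK mulmxA.
Qed.

Lemma mpinv_exists (C : numClosedFieldType) m n (B : 'M[C]_(m, n)) :
  exists G, is_mpinv B G.
Proof.
eexists; rewrite -{1}[B]mulmx_base.
exact: full_rank_is_mpinv (col_base_full B) (row_base_free B).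
Qed.

Lemma mpinvP (C : numClosedFieldType) m n (B : 'M[C]_(m, n)) :
  is_mpinv B (mpinv B).
Proof. exact: (xgetPex (P := is_mpinv B) 0 (mpinv_exists B)). Qed.

(** The orthogonal projector onto a range is the only one: [F = E F] and
    [E = F E] are adjoint to each other. *)
Lemma mul_mpinv_unique (C : numClosedFieldType) m n (B : 'M[C]_(m, n))
    (F : 'M[C]_m) (S : 'M[C]_(n, m)) :
  F^t* = F -> F *m B = B -> F = B *m S -> F = B *m mpinv B.
Proof.
move=> hF FB eF; have [BGB _ hE _] := mpinvP B.
have EF : B *m mpinv B *m F = F by rewrite eF mulmxA BGB.
by rewrite -[LHS]hF -[in LHS]EF trmxC_mul hE hF mulmxA FB.
Qed.

(** * The weighted core-EP inverse *)

(** Injectivity of [W A W] on the range of [(AW) ^ k]: multiplying by [A]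
    turns it into [(AW) ^ 2], which loses no rank there. *)
Lemma windex_cancel (F : fieldType) m n p (A : 'M[F]_(m, n)) (W : 'M[F]_(n, m))
    (Z Z' : 'M[F]_(m, p)) :
  let P := (A *m W) ^+ windex A W in
  W *m A *m W *m (P *m Z) = W *m A *m W *m (P *m Z') -> P *m Z = P *m Z'.
Proof.
move=> P /(congr1 (mulmx A)).
have [[S eS] _] := mxind_expr 2 (leq_maxl (mxind (A *m W)) (mxind (W *m A))).
have lift (U : 'M_(m, p)) :
    P *m U = S *m (A *m (W *m A *m W *m (P *m U))).
  by rewrite {1}/P eS addn2 !mxexpS -/P !mulmxA.
by move=> eZ; rewrite lift eZ -lift.
Qed.

Lemma is_wcEP_unique (C : numClosedFieldType) m n (A : 'M[C]_(m, n))
    (W : 'M[C]_(n, m)) (Y Y' : 'M[C]_(m, n)) :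
  is_wcEP A W Y -> is_wcEP A W Y' -> Y = Y'.
Proof.
move=> [eY /mxrange_subP[Z eZ]] [eY' /mxrange_subP[Z' eZ']].
by move: eY; rewrite -eY' eZ eZ'; apply: windex_cancel.
Qed.

(** The form in which the range of [(WA) ^ k] is used: every column is [W A W]
    applied to a column of [(AW) ^ k], because [(WA) ^ k = (WA) ^ (k + 2) T]. *)
Lemma windex_expr_factor (F : fieldType) m n (A : 'M[F]_(m, n))
    (W : 'M[F]_(n, m)) (k := windex A W) :
  exists T, (W *m A) ^+ k = W *m (A *m W) ^+ k.+1 *m A *m T.
Proof.
have [_ [T eT]] := mxind_expr 2 (leq_maxr (mxind (A *m W)) (mxind (W *m A))).
by exists T; rewrite mxexp_intertwine -(mulmxA _ W) -mxexpSr -addn2.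
Qed.

Lemma is_wcEP_exists (C : numClosedFieldType) m n (A : 'M[C]_(m, n))
    (W : 'M[C]_(n, m)) :
  exists Y, is_wcEP A W Y.
Proof.
have [T eT] := windex_expr_factor A W.
exists ((A *m W) ^+ windex A W *m (A *m T *m mpinv ((W *m A) ^+ windex A W))).
split; last by apply/mxrange_subP; eexists.
by rewrite {2}eT mxexpS !mulmxA.
Qed.

Lemma wcEPP (C : numClosedFieldType) m n (A : 'M[C]_(m, n))
    (W : 'M[C]_(n, m)) :
  is_wcEP A W (wcEP A W).
Proof. exact: (xgetPex (P := is_wcEP A W) 0 (is_wcEP_exists A W)). Qed.

(** In the first two equations both sides have the form [(AW) ^ k U], so it is
    enough to compare them after multiplication by [W A W]; there [W A W X] is
    a projector acting as the identity. *)
Lemma is_wcEP_equations (C : numClosedFieldType) m n (A X : 'M[C]_(m, n))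
    (W : 'M[C]_(n, m)) (k := windex A W) :
  is_wcEP A W X ->
  [/\ X *m W *m (A *m W) ^+ k.+1 = (A *m W) ^+ k,
      A *m W *m X *m W *m X = X
    & (W *m A *m W *m X)^t* = W *m A *m W *m X].
Proof.
move=> [eX /mxrange_subP[Z eZ]].
have [EQ _ hE _] := mpinvP ((W *m A) ^+ k).
(* [W (AW)^k = (WA)^k W] has its columns in the range of the projector. *)
have fixQ p (U : 'M_(m, p)) : W *m A *m W *m X *m (W *m ((A *m W) ^+ k *m U))
    = W *m ((A *m W) ^+ k *m U).
  have -> : W *m ((A *m W) ^+ k *m U) = (W *m A) ^+ k *m (W *m U).
    by rewrite mulmxA mxexp_intertwine mulmxA.
  by rewrite eX mulmxA EQ.
split; last by rewrite eX.
- have eL : X *m W *m (A *m W) ^+ k.+1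
      = (A *m W) ^+ k *m (Z *m W *m (A *m W) ^+ k.+1) by rewrite eZ !mulmxA.
  rewrite -[RHS]mulmx1 eL; apply: windex_cancel; rewrite -eL mulmx1.
  by have := fixQ _ (A *m W); rewrite -mxexpSr mxexpS !mulmxA.
- have eL : A *m W *m X *m W *m X = (A *m W) ^+ k *m (A *m W *m Z *m W *m X).
    by rewrite {1}eZ !mulmxA -mxexpS mxexpSr !mulmxA.
  rewrite eL eZ; apply: windex_cancel; rewrite -eZ -eL.
  have := congr1 (mulmx (W *m A)) (fixQ _ Z).
  by rewrite -eZ !mulmxA.
Qed.

(** [X W] inverts [A W] on the range of [(AW) ^ k]; conjugated by [W], this says
    that [W A W X] fixes [(WA) ^ k]. *)
Lemma equations_is_wcEP (C : numClosedFieldType) m n (A X : 'M[C]_(m, n))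
    (W : 'M[C]_(n, m)) (k := windex A W) :
  X *m W *m (A *m W) ^+ k.+1 = (A *m W) ^+ k ->
  A *m W *m X *m W *m X = X ->
  (W *m A *m W *m X)^t* = W *m A *m W *m X ->
  is_wcEP A W X.
Proof.
move=> e1 e2 e3.
have eX j : X = (A *m W) ^+ j *m (X *m (W *m X) ^+ j).
  elim: j => [|j {1}->]; first by rewrite !expr0 mul1mx mulmx1.
  by rewrite -{1}e2 mxexpSr mxexpS !mulmxA.
split; last by apply/mxrange_subP; eexists; exact: eX.
apply: (mul_mpinv_unique (S := W *m A *m W *m (X *m (W *m X) ^+ k)) e3).
- have [T eT] := windex_expr_factor A W.
  rewrite {1}eT [in RHS]eT mxexpS -!mulmxA.
  congr (W *m _); rewrite !mulmxA.
  by rewrite -/k -[in RHS]e1 mxexpS !mulmxA.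
- rewrite {1}(eX k) [RHS]mulmxA -(mulmxA W) mulmxA -[in LHS](mulmxA W).
  by rewrite -mxexpS mxexpSr !mulmxA mxexp_intertwine.
Qed.

Theorem theorem2p3 (R : realType) (m n : nat)
    (A X : 'M[R[i]]_(m, n)) (W : 'M[R[i]]_(n, m))
    (k : nat) (hk : k = maxn (mxind (A *m W)) (mxind (W *m A))) :
  wcEP A W = X <->
  [/\ X *m W *m (A *m W) ^+ k.+1 = (A *m W) ^+ k,
      A *m W *m X *m W *m X = X
    & (W *m A *m W *m X)^t* = W *m A *m W *m X].
Proof.
rewrite hk; split=> [<- | [e1 e2 e3]].
  exact/is_wcEP_equations/wcEPP.
exact: is_wcEP_unique (wcEPP A W) (equations_is_wcEP e1 e2 e3).
Qed.
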